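(* For every $N>2$, every integer $\ell$ and every $x$ with $1\le x\le N-1$, $$R(N,\ell,x)=\sum_{i=\max(x,2)}^{N-2} R(N-1,\ell-1,i)+\sum_{i=1}^{\max(x-1,1)} R(N-1,\ell,i).$$
   Context: A recursive tree on $N$ vertices is a tree whose vertices are labeled $0,1,\dots,N-1$, rooted at $0$, such that labels strictly increase along every path from the root. Its smallest rooted path is the path starting at the root that at each vertex proceeds to the child with the smallest label, until it reaches a vertex with no children. $R(N,\ell,x)$ denotes the number of recursive trees on $N$ vertices having exactly $\ell$ vertices of degree $1$ (the root counts if it has degree $1$) and whose smallest rooted path ends at the vertex labeled $x$. *)

(* Defs.v *)
From mathcomp Require Import all_boot all_order all_algebra.
From mathcomp Require Import boolp.

Set Implicit Arguments.
Unset Strict Implicit.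
Unset Printing Implicit Defensive.

Section Graph.

Variable V : finType.
Implicit Types (E : {set {set V}}) (u v : V).

(* A simple graph on V is given by its set of edges, i.e. of 2-element sets. *)
Definition simple_graph E : Prop := forall e, e \in E -> #|e| = 2.

Definition adj E : rel V := fun u v => [set u; v] \in E.

Definition degree E u : nat := #|[set v | adj E u v]|.

Definition num_leaves E : nat := #|[set u | degree E u == 1]|.

Definition graph_connected E : Prop := forall u v, connect (adj E) u v.

(* [ucycle] also accepts the degenerate cycles [:: u; v] that traverse one edge
   back and forth, so genuine cycles are those with at least 3 vertices. *)
Definition graph_acyclic E : Prop :=
  forall c : seq V, 2 < size c -> ~ ucycle (adj E) c.

Definition is_tree E : Prop :=
  [/\ simple_graph E, graph_connected E & graph_acyclic E].

End Graph.

Section RecursiveTree.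

Variable n : nat.
Implicit Types (E : {set {set 'I_n.+1}}) (u v w x : 'I_n.+1).

(* [p] lists the vertices that follow the root [ord0] on the path. *)
Definition root_path E (p : seq 'I_n.+1) : Prop :=
  path (adj E) ord0 p /\ uniq (ord0 :: p).

Definition recursive_tree E : Prop :=
  is_tree E /\
  forall p, root_path E p -> path (fun u v => u < v) ord0 p.

Definition child E u v : Prop :=
  exists2 p, root_path E (rcons p v) & last ord0 p = u.

Definition smallest_child E u v : Prop :=
  child E u v /\ forall w, child E u w -> v <= w.

Definition smallest_root_path E (p : seq 'I_n.+1) : Prop :=
  path (fun u v => `[< smallest_child E u v >]) ord0 p /\
  ~ exists w, child E (last ord0 p) w.

End RecursiveTree.

(* No tree on 0 vertices has a root.  [l] is an integer so that [l - 1] is not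
   truncated. *)
Definition R (N : nat) (l : int) (x : nat) : nat :=
  if N is n.+1 then
    #|[set E : {set {set 'I_n.+1}} | `[<
        [/\ recursive_tree E,
            Posz (num_leaves E) = l &
            exists2 p, smallest_root_path E p & last ord0 p = x :> nat] >] ]|
  else 0.

(* Main.v *)
(** A recursive tree is encoded by its parent function [f], with [f v < v] for
[v != 0] and [f 0 = 0].  Deleting the leaf [x] at the end of the smallest path
and closing the gap in the labels is a bijection from the trees on [N] vertices
ending at [x] to all trees on [N - 1] vertices: in the other direction [x] must
be attached to the largest vertex [v < x] of the smallest path.  The leaf count
grows by one, unless [v] was itself a leaf.  For [x >= 2] this happens exactly
when the smaller tree ends before [x].  For [x = 1] it happens when the root has
degree 1, whereas the formula asks for vertex 1 to have degree 1; exchanging the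
labels 0 and 1, which are always adjacent, matches the two conditions. *)

Require Import Defs.
From mathcomp Require Import all_boot all_order all_algebra.
From mathcomp Require Import perm boolp zify.

Set Implicit Arguments.
Unset Strict Implicit.
Unset Printing Implicit Defensive.

(** * Recursive trees as parent functions *)

Section ParentFunctions.

Variable n : nat.
Implicit Types (f : {ffun 'I_n.+1 -> 'I_n.+1}) (E : {set {set 'I_n.+1}}).
Implicit Types u v w c : 'I_n.+1.

(** The value at the root is pinned to [ord0], so that a tree has only one parent function. *)
Definition parent_fun f : bool :=
  (f ord0 == ord0) && [forall v, (v != ord0) ==> (f v < v)].

Definition tree_of f : {set {set 'I_n.+1}} :=
  [set [set v; f v] | v in [set v | v != ord0]].

(** The first conjunct keeps the root from being its own child, since [f ord0 = ord0]. *)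
Definition is_child f u v : bool := (v != ord0) && (f v == u).

Lemma parent_fun0 f : parent_fun f -> f ord0 = ord0.
Proof. by case/andP=> /eqP. Qed.

Lemma parent_fun_lt f v : parent_fun f -> v != ord0 -> f v < v.
Proof. by case/andP=> _ /forallP/(_ v)/implyP. Qed.

Lemma is_child_lt f u v : parent_fun f -> is_child f u v -> u < v.
Proof. by move=> pf /andP[v0 /eqP <-]; exact: parent_fun_lt. Qed.

Lemma lt_neq0 u v : u < v -> v != ord0.
Proof. by apply: contraTneq => ->. Qed.

Lemma set2_inj_lt u v u' v' :
  u < v -> u' < v' -> [set v; u] = [set v'; u'] -> u = u' /\ v = v'.
Proof.
move=> uv uv' eqs.
have hv : v \in [set v'; u'] by rewrite -eqs set21.
have hu : u \in [set v'; u'] by rewrite -eqs set22.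
case/set2P: hv => hv; case/set2P: hu => hu; subst; split=> //; lia.
Qed.

Lemma adj_tree_of f u v : parent_fun f ->
  adj (tree_of f) u v = is_child f u v || is_child f v u.
Proof.
move=> pf; apply/idP/idP.
  case/imsetP=> w; rewrite inE => w0 eqs.
  have lt := parent_fun_lt pf w0.
  have hu : u \in [set w; f w] by rewrite -eqs set21.
  have hv : v \in [set w; f w] by rewrite -eqs set22.
  have hw : w \in [set u; v] by rewrite eqs set21.
  have hf : f w \in [set u; v] by rewrite eqs set22.
  rewrite /is_child; case/set2P: hw => hw; case/set2P: hf => hf; subst.
  - by move: lt; rewrite hf ltnn.
  - by rewrite w0 eqxx orbT.
  - by rewrite w0 eqxx.
  - by move: lt; rewrite hf ltnn.
case/orP=> /andP[w0 /eqP <-]; last by apply: imset_f; rewrite inE.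
by rewrite /adj setUC; apply: imset_f; rewrite inE.
Qed.

Lemma tree_of_inj f g :
  parent_fun f -> parent_fun g -> tree_of f = tree_of g -> f = g.
Proof.
move=> pf pg eqt; apply/ffunP=> v.
have [->|v0] := eqVneq v ord0; first by rewrite !parent_fun0.
have : [set v; f v] \in tree_of g by rewrite -eqt; apply: imset_f; rewrite inE.
case/imsetP=> w; rewrite inE => w0 eqs.
by case: (set2_inj_lt (parent_fun_lt pf v0) (parent_fun_lt pg w0) eqs) => -> ->.
Qed.

(* In a simple path from the root, a step towards the parent would revisit the
   previous vertex. *)
Lemma root_path_tree_of f p : parent_fun f ->
  root_path (tree_of f) p -> path (is_child f) ord0 p.
Proof.
move=> pf; elim/last_ind: p => [//|p v IH] [].
rewrite !rcons_path -rcons_cons rcons_uniq => /andP[pp luv] /andP[vp up].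
have {}IH := IH (conj pp up); rewrite IH /=.
move: luv; rewrite adj_tree_of // => /orP[//|/andP[l0 /eqP fl]].
case/lastP: p {pp up} IH vp l0 fl => [|p u] //.
rewrite last_rcons rcons_path => /andP[_ /andP[_ /eqP fu]] vp _ fv.
have : last ord0 p \in ord0 :: p by exact: mem_last.
by rewrite -fu fv => hv; case/negP: vp; rewrite -rcons_cons mem_rcons inE hv orbT.
Qed.

Lemma is_child_path_root f p : parent_fun f ->
  path (is_child f) ord0 p -> root_path (tree_of f) p.
Proof.
move=> pf pp; split.
  by apply: sub_path pp => u v uv; rewrite adj_tree_of // uv.
apply: (@sorted_uniq _ (fun u v => u < v)) => //.
- by move=> a b c; exact: ltn_trans.
- by move=> a; exact: ltnn.
- by apply: sub_path pp => u v; exact: is_child_lt.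
Qed.

Lemma ancestor_path f v : parent_fun f ->
  exists2 p, path (is_child f) ord0 p & last ord0 p = v.
Proof.
move=> pf; have [m] := ubnP (v : nat); elim: m v => // m IH v vm.
have [->|v0] := eqVneq v ord0; first by exists [::].
have lt := parent_fun_lt pf v0.
have [|p pp lp] := IH (f v); first by lia.
by exists (rcons p v); rewrite ?last_rcons // rcons_path pp lp /is_child v0 eqxx.
Qed.

Lemma child_tree_of f u v : parent_fun f ->
  child (tree_of f) u v <-> is_child f u v.
Proof.
move=> pf; split=> [[p rp <-]|uv].
  by have := root_path_tree_of pf rp; rewrite rcons_path => /andP[].
have [p pp lp] := ancestor_path u pf.
by exists p => //; apply: is_child_path_root => //; rewrite rcons_path pp lp.
Qed.

Lemma tree_of_recursive f : parent_fun f -> recursive_tree (tree_of f).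
Proof.
move=> pf.
have adjS : symmetric (adj (tree_of f)).
  by move=> u v; rewrite !adj_tree_of // orbC.
have incr p : root_path (tree_of f) p -> path (fun u v => u < v) ord0 p.
  by move/(root_path_tree_of pf); apply: sub_path => u v; exact: is_child_lt.
split=> //; split.
- move=> e /imsetP[v]; rewrite inE => v0 ->.
  by rewrite cards2; have := parent_fun_lt pf v0; case: eqVneq => // <-; rewrite ltnn.
- have c0 v : connect (adj (tree_of f)) ord0 v.
    have [p pp <-] := ancestor_path v pf; apply/connectP; exists p => //.
    by case: (is_child_path_root pf pp).
  move=> u v; apply: connect_trans (c0 v).
  by rewrite (sym_connect_sym adjS).
- move=> c sc /andP[cc uc].
  (* Both neighbours of the largest vertex of a cycle would be its parent. *)
  have [m mc maxm] : exists2 m, m \in c & forall w, w \in c -> w <= m.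
    case: c sc {cc uc} => // a c _.
    have [m mc h] := @arg_maxnP _ a (mem (a :: c)) (fun v => v : nat) (mem_head _ _).
    by exists m.
  have [i c' e] := rot_to mc.
  have cc' : cycle (adj (tree_of f)) (m :: c') by rewrite -e rot_cycle.
  have uc' : uniq (m :: c') by rewrite -e rot_uniq.
  have sc' : 1 < size c' by move: sc; rewrite -(size_rot i) e.
  have maxm' w : w \in c' -> w <= m.
    by move=> wc; apply: maxm; rewrite -(mem_rot i) e inE wc orbT.
  have down w : w \in c' -> adj (tree_of f) m w -> w = f m.
    move=> wc; rewrite adj_tree_of // => /orP[/(is_child_lt pf)|/andP[_ /eqP->//]].
    by have := maxm' w wc; lia.
  case: c' sc' cc' uc' down {e maxm'} => // a c'; case/lastP: c' => // c' b _.
  rewrite /= rcons_path last_rcons mem_rcons => /and3P[ma _ bm] /and3P[_ ab _] down.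
  have ea : a = f m by apply: down => //; rewrite mem_head.
  have eb : b = f m.
    by apply: down; [rewrite inE mem_rcons mem_head orbT | rewrite adjS].
  by move: ab; rewrite inE ea eb eqxx.
Qed.

(** Labels increase along rooted paths, so [u] and [u'] are both joined to the root through labels
    below [v]. If they differed, a simple path between them avoiding [v] would close up through [v]
    to a cycle. *)
Lemma recursive_lower_adj_uniq E u u' v : recursive_tree E ->
  u < v -> u' < v -> adj E u v -> adj E u' v -> u = u'.
Proof.
case=> -[_ conn acyc] incr uv u'v auv au'v; apply/eqP/negPn/negP => neq.
have adjS : symmetric (adj E) by move=> a b; rewrite /adj setUC.
(* Adjacency restricted to the labels below [v]. *)
pose e : rel 'I_n.+1 := fun a b => [&& adj E a b, a < v & b < v].
have eS : symmetric e by move=> a b; rewrite /e adjS; congr andb; exact: andbC.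
have c0 w : w < v -> connect e ord0 w.
  move=> wv; have /connectP[p0 pp0 lp0] := conn ord0 w.
  move: lp0; case: (shortenP pp0) => p pp up _ lp {p0 pp0}.
  apply/connectP; exists p => //.
  have : path (fun u v => u < v) ord0 p by apply: incr.
  clear up; elim/last_ind: p w wv pp lp => // p b IH w wv.
  rewrite !rcons_path last_rcons => /andP[pp ab] wb /andP[ip lb].
  rewrite {}wb in wv; have lv := ltn_trans lb wv.
  by rewrite (IH _ lv) //= /e ab lv.
have : connect e u u'.
  by apply: connect_trans (c0 _ u'v); rewrite (sym_connect_sym eS) c0.
case/connectP=> p0 pp0 lp0; move: lp0; case: (shortenP pp0) => p pp up _ lp.
case: p pp up lp => [|a p] pp up lp; first by rewrite lp /= eqxx in neq.
apply: (acyc [:: v, u, a & p]) => //; apply/andP; split.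
  rewrite /cycle rcons_path.
  have -> /= : adj E (last v [:: u, a & p]) v by rewrite /= -[last a p]lp.
  rewrite andbT adjS auv /=.
  by apply: (@sub_path _ e) pp => b c /andP[].
rewrite cons_uniq up andbT inE negb_or; apply/andP; split.
  by apply: contraTneq uv => ->; rewrite ltnn.
apply/negP => vp; have : all (fun b : 'I_n.+1 => b < v) (a :: p).
  elim: (a :: p) (u) pp => //= b q IH w /andP[/and3P[_ _ ->] /IH].
  by [].
by move/allP/(_ v vp); rewrite ltnn.
Qed.

(** The last step of a simple path from the root to [v] goes up in label, so its source serves as
    [u]. *)
Lemma recursive_parent E v : recursive_tree E -> v != ord0 ->
  exists2 u : 'I_n.+1, u < v & adj E u v.
Proof.
case=> -[_ conn _] incr v0; have /connectP[p0 pp0 lp0] := conn ord0 v.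
move: lp0; case: (shortenP pp0) => p pp up _ lp.
case/lastP: p pp up lp => [_ _ e|p b pp up lp]; first by rewrite e in v0.
have := incr _ (conj pp up); rewrite last_rcons in lp; subst b.
move: pp; rewrite !rcons_path => /andP[_ a] /andP[_ b].
by exists (last ord0 p).
Qed.

Lemma recursive_treeP E :
  recursive_tree E <-> exists2 f, parent_fun f & E = tree_of f.
Proof.
split=> [rE|[f pf ->]]; last exact: tree_of_recursive.
(* No label is below the root, so the default gives [f ord0 = ord0]. *)
pose f := [ffun v : 'I_n.+1 => odflt ord0 [pick u : 'I_n.+1 | (u < v) && adj E u v]].
have fP v : v != ord0 -> f v < v /\ adj E (f v) v.
  move=> v0; rewrite ffunE; case: pickP => [u /andP[]|h] //=.
  by have [u uv a] := recursive_parent rE v0; have := h u; rewrite uv a.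
exists f.
  apply/andP; split; last by apply/forallP=> v; apply/implyP=> /fP[].
  by rewrite ffunE; case: pickP => // u; rewrite ltn0.
have simp : simple_graph E by case: rE => -[].
apply/setP=> s; apply/idP/imsetP=> [sE|[v]]; last first.
  by rewrite inE => /fP[_]; rewrite /adj setUC => a ->.
have /eqP/cards2P[a [b [ab es]]] := simp _ sE.
wlog lt : a b ab es / a < b.
  move=> W; have [lt|lt|e] := ltngtP a b; first exact: (W a b).
    by apply: (W b a) => //; [rewrite eq_sym | rewrite setUC].
  by rewrite (val_inj e) eqxx in ab.
have b0 := lt_neq0 lt; exists b; first by rewrite inE.
have [fb afb] := fP _ b0.
by rewrite es setUC (recursive_lower_adj_uniq rE fb lt afb) // /adj -es.
Qed.

(** * Smallest path, degrees and leaves read off the parent function *)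

Definition smallest_step f : rel 'I_n.+1 :=
  fun u v => is_child f u v && [forall w, is_child f u w ==> (v <= w)].

(** A vertex has at most one successor under [smallest_step], so the vertices reachable from the
    root are exactly those of the smallest path. *)
Definition on_path f v : bool := connect (smallest_step f) ord0 v.

Definition path_end f v : bool := on_path f v && [forall w, ~~ is_child f v w].

(** The first summand is the edge to the parent. *)
Definition deg f u : nat := (u != ord0) + \sum_v is_child f u v.

Definition leaves f : nat := \sum_u (deg f u == 1).

Lemma smallest_child_tree_of f u v : parent_fun f ->
  smallest_child (tree_of f) u v <-> smallest_step f u v.
Proof.
move=> pf; split=> [[/(child_tree_of _ _ pf) uv h]|/andP[uv /forallP h]].
  rewrite /smallest_step uv; apply/forallP=> w; apply/implyP=> uw.
  by apply: h; apply/child_tree_of.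
split; first exact/child_tree_of.
by move=> w /(child_tree_of _ _ pf) uw; have /implyP := h w; apply.
Qed.

Lemma path_end_tree_of f v : parent_fun f ->
  (exists2 p, smallest_root_path (tree_of f) p & last ord0 p = v) <-> path_end f v.
Proof.
move=> pf.
have es : (fun u v => `[< smallest_child (tree_of f) u v >]) =2 smallest_step f.
  by move=> a b; apply/asboolP/idP => /(smallest_child_tree_of _ _ pf).
split=> [[p [pp nc] lp]|/andP[/connectP[p pp lp] /forallP nc]].
  apply/andP; split; first by apply/connectP; exists p; rewrite -?(eq_path es).
  apply/forallP=> w; apply/negP=> vw; apply: nc; exists w.
  by rewrite lp; apply/child_tree_of.
exists p => //; split; first by rewrite (eq_path es).
by case=> w /(child_tree_of _ _ pf); rewrite -lp => vw; have := nc w; rewrite vw.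
Qed.

Lemma degree_tree_of f u : parent_fun f -> degree (tree_of f) u = deg f u.
Proof.
move=> pf; rewrite /degree /deg.
rewrite -[X in _ + X]big_mkcond /= sum1dep_card.
have -> : [set v | adj (tree_of f) u v] =
    [set v | is_child f u v] :|: [set v | is_child f v u].
  by apply/setP=> v; rewrite !inE adj_tree_of.
rewrite cardsU [X in _ - X](_ : _ = 0); last first.
  apply/eqP; rewrite cards_eq0; apply/eqP/setP=> v; rewrite !inE.
  apply/negP=> /andP[/(is_child_lt pf) a /(is_child_lt pf) b]; lia.
rewrite subn0 addnC; congr (_ + _).
have [->|u0] := eqVneq u ord0.
  by apply/eqP; rewrite cards_eq0; apply/eqP/setP=> v; rewrite !inE /is_child eqxx.
transitivity #|[set f u]|; last by rewrite cards1.
apply: eq_card => v; rewrite !inE /is_child u0 /=.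
by rewrite eq_sym.
Qed.

Lemma num_leaves_tree_of f : parent_fun f -> num_leaves (tree_of f) = leaves f.
Proof.
move=> pf; rewrite /num_leaves /leaves -[RHS]big_mkcond /= sum1dep_card.
by apply: eq_card => u; rewrite !inE degree_tree_of.
Qed.

Lemma R_parent_fun (l : int) v :
  R n.+1 l v = #|[set f | [&& parent_fun f, Posz (leaves f) == l & path_end f v]]|.
Proof.
rewrite /R -(card_in_imset (f := tree_of)); last first.
  move=> f g; rewrite !inE => /andP[pf _] /andP[pg _]; exact: tree_of_inj.
apply: eq_card => E; rewrite inE; apply/asboolP/imsetP.
  case=> /recursive_treeP[f pf ->] <- [p sp lp]; exists f => //.
  rewrite inE pf num_leaves_tree_of // eqxx; apply/(path_end_tree_of _ pf).
  by exists p => //; apply: val_inj.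
case=> f; rewrite inE => /and3P[pf /eqP <- /(path_end_tree_of _ pf)[p sp lp]] ->.
split; [exact: tree_of_recursive | by rewrite num_leaves_tree_of |].
by exists p => //; rewrite lp.
Qed.

End ParentFunctions.

(** * Order of the labels on the smallest path *)

Section SmallestPath.

Variables (n : nat) (f : {ffun 'I_n.+1 -> 'I_n.+1}).
Hypothesis pf : parent_fun f.
Implicit Types u v w c x : 'I_n.+1.

Lemma on_path0 : on_path f ord0.
Proof. exact: connect0. Qed.

Lemma on_path_step u v : on_path f u -> smallest_step f u v -> on_path f v.
Proof. by move=> hu /connect1; exact: connect_trans. Qed.

Lemma on_path_parent v : on_path f v -> v != ord0 ->
  on_path f (f v) /\ smallest_step f (f v) v.
Proof.
case/connectP=> p; case/lastP: p => [_ -> //|p b].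
rewrite rcons_path last_rcons => /andP[pp st] -> _.
have /andP[/andP[_ /eqP fb] _] := st; rewrite fb; split=> //.
by apply/connectP; exists p.
Qed.

Lemma smallest_step_exists u w : is_child f u w ->
  exists2 c, smallest_step f u c & c <= w.
Proof.
move=> uw; have [c uc minc] := arg_minnP (fun v => v : nat) uw.
exists c; last exact: minc.
by rewrite /smallest_step uc; apply/forallP=> v; apply/implyP; exact: minc.
Qed.

(** Induction on [f c + v], comparing the parents of [c] and [v]. If they agree, [c] is the smallest
    child; otherwise the vertex with the larger parent is replaced by that parent. *)
Lemma on_path_gap c v : on_path f c -> c != ord0 -> on_path f v ->
  (v <= f c) || (c <= v).
Proof.
have [m] := ubnP (f c + v); elim: m c v => // m IH c v lem hc c0 hv.
have [->|v0] := eqVneq v ord0; first by rewrite leq0n.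
have [hfc /andP[_ /forallP minc]] := on_path_parent hc c0.
have [hfv _] := on_path_parent hv v0.
have ltv := parent_fun_lt pf v0.
have [lt|gt|e] := ltngtP (f v) (f c).
- have := IH v (f c); rewrite hv v0 hfc => /(_ _ isT isT isT); lia.
- have := IH c (f v); rewrite hc c0 hfv => /(_ _ isT isT isT); lia.
- apply/orP; right; apply: (implyP (minc v)).
  by rewrite /is_child v0; apply/eqP/val_inj.
Qed.

(** Climb from [v] towards the root: by [on_path_gap] the parents stay at or above [w], so the climb
    meets [w], and the vertex just before it is [c]. *)
Lemma on_path_child_between w v : on_path f w -> on_path f v -> w < v ->
  exists2 c, is_child f w c & c <= v.
Proof.
have [m] := ubnP (v : nat); elim: m v => // m IH v vm hw hv wv.
have v0 := lt_neq0 wv; have ltv := parent_fun_lt pf v0.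
have [hfv _] := on_path_parent hv v0.
have := on_path_gap hv v0 hw; rewrite (leqNgt v w) wv orbF leq_eqVlt.
case/orP=> [/eqP e|lt].
  by exists v => //; rewrite /is_child v0; apply/eqP/val_inj.
have [||||c wc cv] := IH (f v) => //; first by lia.
by exists c => //; lia.
Qed.

Lemma path_end_max x v : path_end f x -> on_path f v -> v <= x.
Proof.
case/andP=> hx /forallP nc hv; rewrite leqNgt; apply/negP=> lt.
have [c xc _] := on_path_child_between hx hv lt.
by have := nc c; rewrite xc.
Qed.

Lemma path_end_uniq x y : path_end f x -> path_end f y -> x = y.
Proof.
move=> ex ey; have /andP[hx _] := ex; have /andP[hy _] := ey.
by apply/val_inj/eqP; rewrite eqn_leq (path_end_max ex hy) (path_end_max ey hx).
Qed.

Lemma path_end_exists : exists x, path_end f x.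
Proof.
have [x hx maxx] := arg_maxnP (fun v => v : nat) on_path0.
exists x; rewrite /path_end hx; apply/forallP=> w; apply/negP=> xw.
have [c st _] := smallest_step_exists xw.
have := maxx c (on_path_step hx st).
by have /andP[/(is_child_lt pf) lt _] := st; rewrite /= leqNgt lt.
Qed.

End SmallestPath.

(** * Inserting a leaf at the end of the smallest path *)

Section Insertion.

Variables (n : nat) (x : 'I_n.+2).
Hypothesis x0 : x != ord0.
Implicit Types (g : {ffun 'I_n.+1 -> 'I_n.+1}) (f : {ffun 'I_n.+2 -> 'I_n.+2}).
Implicit Types v w c : 'I_n.+1.

(** Labels below [x] are unchanged by [lift x], so [v < x] means the same before and after the
    insertion. The fallback [ord0] satisfies the predicate because [x] is positive. *)
Definition attach_point g : 'I_n.+1 :=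
  [arg max_(v > ord0 | on_path g v && (v < x)) v].

(** [lift x] opens a gap at label [x], and [unlift x u] is [None] only for the new vertex
    [u = x]. *)
Definition insert_end g : {ffun 'I_n.+2 -> 'I_n.+2} :=
  [ffun u => lift x (if unlift x u is Some v then g v else attach_point g)].

Lemma ltx0 : 0 < x.
Proof. by rewrite lt0n. Qed.

Lemma lift_ord0 : lift x ord0 = ord0.
Proof. by apply: val_inj; rewrite /= /bump leqNgt ltx0. Qed.

Lemma lift_neq0 v : (lift x v != ord0) = (v != ord0).
Proof. by rewrite -lift_ord0 (inj_eq lift_inj). Qed.

Lemma lift_leE v w : (lift x v <= lift x w) = (v <= w).
Proof. exact: leq_bump2. Qed.

Lemma lift_ltx v : (lift x v < x) = (v < x).
Proof. by rewrite /= /bump; lia. Qed.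

Lemma attach_pointP g :
  [/\ on_path g (attach_point g), attach_point g < x &
      forall v, on_path g v -> v < x -> v <= attach_point g].
Proof.
rewrite /attach_point; case: arg_maxnP; first by rewrite on_path0 ltx0.
by move=> a /andP[ha ax] maxa; split=> // v hv vx; apply: maxa; rewrite hv.
Qed.

Lemma insert_end_x g : insert_end g x = lift x (attach_point g).
Proof. by rewrite ffunE unlift_none. Qed.

Lemma insert_end_lift g v : insert_end g (lift x v) = lift x (g v).
Proof. by rewrite ffunE liftK. Qed.

Lemma is_child_insert_lift g v w :
  is_child (insert_end g) (lift x v) (lift x w) = is_child g v w.
Proof. by rewrite /is_child lift_neq0 insert_end_lift (inj_eq lift_inj). Qed.

Lemma is_child_insert_x g v :
  is_child (insert_end g) (lift x v) x = (v == attach_point g).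
Proof. by rewrite /is_child x0 insert_end_x (inj_eq lift_inj) eq_sym. Qed.

Lemma is_child_insert_of_x g u : is_child (insert_end g) x u = false.
Proof.
by apply/negP=> /andP[_]; rewrite ffunE eq_sym (negPf (neq_lift _ _)).
Qed.

Lemma insert_end_inj : injective insert_end.
Proof.
move=> g h e; apply/ffunP=> v; apply: (@lift_inj _ x).
by rewrite -!insert_end_lift e.
Qed.

Lemma insert_end_parent_fun g : parent_fun g -> parent_fun (insert_end g).
Proof.
move=> pg; apply/andP; split.
  by rewrite -{1}lift_ord0 insert_end_lift parent_fun0 // lift_ord0.
apply/forallP=> u; apply/implyP; case: (unliftP x u) => [v|] -> u0.
  rewrite insert_end_lift ltnNge lift_leE -ltnNge.
  by apply: parent_fun_lt => //; rewrite -lift_neq0.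
by rewrite insert_end_x lift_ltx; case: (attach_pointP g).
Qed.

(** Only the attachment point gains a child, so the smallest path is unaffected up to that point. *)
Lemma insert_end_on_path g v : parent_fun g -> on_path g v ->
  v <= attach_point g -> on_path (insert_end g) (lift x v).
Proof.
move=> pg; have [m] := ubnP (v : nat); elim: m v => // m IH v vm hv va.
have [->|v0] := eqVneq v ord0; first by rewrite lift_ord0 on_path0.
have lt := parent_fun_lt pg v0.
have [hgv /andP[cv /forallP minv]] := on_path_parent hv v0.
apply: (@on_path_step _ _ (lift x (g v))); first by apply: IH => //; lia.
rewrite /smallest_step is_child_insert_lift cv; apply/forallP=> u.
apply/implyP; case: (unliftP x u) => [w|] ->.
  by rewrite is_child_insert_lift lift_leE; apply/implyP.
by rewrite is_child_insert_x => /eqP e; move: lt va; rewrite e; lia.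
Qed.

Lemma insert_end_path_end g : parent_fun g -> path_end (insert_end g) x.
Proof.
move=> pg; have [ha ax maxa] := attach_pointP g.
apply/andP; split; last by apply/forallP=> u; rewrite is_child_insert_of_x.
apply: (on_path_step (insert_end_on_path pg ha (leqnn _))).
rewrite /smallest_step is_child_insert_x eqxx; apply/forallP=> u.
apply/implyP; case: (unliftP x u) => [w|] -> //.
rewrite is_child_insert_lift => /smallest_step_exists[c st cw].
have /andP[/(is_child_lt pg) ac _] := st.
(* The smallest child [c] of the attachment point is again on the path; below [x] it would
   contradict the maximality of that point. *)
have xc : x <= c.
  rewrite leqNgt; apply/negP=> cx.
  by have := maxa c (on_path_step ha st) cx; lia.
by rewrite /= /bump; lia.
Qed.

(** Being childless, [x] can be deleted and the gap closed, which gives [g]. What remains is that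
    the parent of [x] was the attachment point. *)
Lemma insert_end_surj f : parent_fun f -> path_end f x ->
  exists2 g, parent_fun g & f = insert_end g.
Proof.
move=> pf /andP[hx /forallP nc].
have [hfx /andP[_ /forallP minx]] := on_path_parent hx x0.
(* The default would be reached only if [x] were the parent of [lift x v], but [x] has no
   children. *)
pose g : {ffun 'I_n.+1 -> 'I_n.+1} :=
  [ffun v => odflt ord0 (unlift x (f (lift x v)))].
have fg v : f (lift x v) = lift x (g v).
  rewrite ffunE; case: unliftP => [w -> //|e].
  have [v0|v0] := eqVneq v ord0.
    by move: e; rewrite v0 lift_ord0 parent_fun0 // => e; case/eqP: x0.
  by have := nc (lift x v); rewrite /is_child lift_neq0 v0 e eqxx.
have isc v w : is_child g v w = is_child f (lift x v) (lift x w).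
  by rewrite /is_child lift_neq0 fg (inj_eq lift_inj).
have pg : parent_fun g.
  apply/andP; split.
    by apply/eqP/(@lift_inj _ x); rewrite -fg lift_ord0 parent_fun0.
  apply/forallP=> v; apply/implyP=> v0.
  by rewrite ltnNge -lift_leE -fg -ltnNge parent_fun_lt // lift_neq0.
have opg v : on_path f (lift x v) -> on_path g v.
  have [m] := ubnP (v : nat); elim: m v => // m IH v vm hv.
  have [->|v0] := eqVneq v ord0; first exact: on_path0.
  have := on_path_parent hv; rewrite lift_neq0 fg => /(_ v0)[hgv].
  case/andP=> cv /forallP minv.
  have lt := parent_fun_lt pg v0.
  apply: (@on_path_step _ _ (g v)); first by apply: IH => //; lia.
  rewrite /smallest_step isc cv; apply/forallP=> w; rewrite isc -lift_leE.
  exact: minv.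
exists g => //; apply/ffunP=> u; case: (unliftP x u) => [v|] ->.
  by rewrite insert_end_lift.
rewrite insert_end_x; have ltx := parent_fun_lt pf x0.
have [ha ax maxa] := attach_pointP g.
case: (unliftP x (f x)) => [w fx|e]; last by move: ltx; rewrite e ltnn.
rewrite fx; congr lift.
rewrite fx lift_ltx in ltx; rewrite fx in hfx.
have hw := opg _ hfx; have := maxa _ hw ltx; rewrite leq_eqVlt.
case/orP=> [/eqP/val_inj//|lt].
(* If the parent [w] of [x] lay below the attachment point, it would have a child below [x], against
   [x] being its smallest child in [f]. *)
have [c wc ca] := on_path_child_between pg hw ha lt.
have := minx (lift x c); rewrite fx -isc wc /= /bump; lia.
Qed.

Lemma deg_insert_x g : deg (insert_end g) x = 1.
Proof.
by rewrite /deg x0 big1 // => u _; rewrite is_child_insert_of_x.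
Qed.

Lemma deg_insert_lift g v :
  deg (insert_end g) (lift x v) = deg g v + (v == attach_point g).
Proof.
rewrite /deg lift_neq0 -addnA; congr (_ + _).
rewrite (bigD1_ord x) //= is_child_insert_x addnC; congr (_ + _).
by apply: eq_bigr => w _; rewrite is_child_insert_lift.
Qed.

End Insertion.

(** * Leaf counts under insertion and under exchange of the labels 0 and 1 *)

Section Leaves.

Variable n : nat.
Implicit Types (g : {ffun 'I_n.+2 -> 'I_n.+2}) (u v w : 'I_n.+2).

Let one : 'I_n.+2 := Ordinal (isT : 1 < n.+2).

Lemma parent_fun1 g : parent_fun g -> g one = ord0.
Proof.
move=> pg; have := @parent_fun_lt _ g one pg isT; rewrite ltnS leqn0 => /eqP e.
exact: val_inj.
Qed.

(* Every vertex has one neighbour besides its children among 2, 3, ...: the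
   root has 1, and the others have their parent. *)
Lemma degE g v : parent_fun g -> deg g v = (\sum_(w : 'I_n.+2 | 1 < w) (g w == v)).+1.
Proof.
move=> pg; rewrite /deg (bigD1 one) //= /is_child /= parent_fun1 // addnA.
rewrite [X in X + _](_ : _ = 1) ?add1n; last first.
  by rewrite [ord0 == v]eq_sym; case: eqVneq.
congr _.+1; rewrite big_mkcond [RHS]big_mkcond; apply: eq_bigr => w _.
rewrite -!(inj_eq val_inj) /=.
by case: (nat_of_ord w) => [|[|m]].
Qed.

Lemma on_path1 g : parent_fun g -> on_path g one.
Proof.
move=> pg; apply: (@on_path_step _ _ ord0); first exact: on_path0.
rewrite /smallest_step /is_child parent_fun1 // eqxx; apply/forallP=> w.
by apply/implyP=> /andP[w0 _]; rewrite lt0n.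
Qed.

(** Off the root, the edge to the parent already accounts for degree 1. *)
Lemma deg_eq1_path_end g v : v != ord0 -> on_path g v ->
  (deg g v == 1) = path_end g v.
Proof.
move=> v0 hv; rewrite /deg /path_end v0 hv eqSS sum_nat_eq0.
by apply: eq_forallb => w; rewrite eqb0.
Qed.

(** Labels increase along the smallest path, so its end is its largest label. *)
Definition path_last g : 'I_n.+2 := [arg max_(v > ord0 | on_path g v) v].

Lemma path_endE g v : parent_fun g -> path_end g v = (v == path_last g).
Proof.
move=> pg; have [x ex] := path_end_exists pg.
have -> : path_last g = x.
  rewrite /path_last; case: arg_maxnP => [|a ha maxa]; first exact: on_path0.
  apply/val_inj/eqP; rewrite eqn_leq (path_end_max pg ex ha).
  by apply: maxa; case/andP: ex.
by apply/idP/eqP=> [ev|-> //]; exact: path_end_uniq ev ex.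
Qed.

Lemma path_last_gt0 g : parent_fun g -> 0 < path_last g.
Proof.
move=> pg; have el : path_end g (path_last g) by rewrite path_endE.
exact: leq_trans (path_end_max pg el (on_path1 pg)).
Qed.

Lemma path_last_eq1 g : parent_fun g -> (path_last g == one) = (deg g one == 1).
Proof. by move=> pg; rewrite deg_eq1_path_end ?on_path1 // path_endE // eq_sym. Qed.

(** The new vertex is a leaf, and only the attachment point changes degree: it stops being a leaf if
    it was one. *)
Lemma leaves_insert_end (x : 'I_n.+3) g : x != ord0 -> parent_fun g ->
  leaves (insert_end x g) + (deg g (attach_point x g) == 1) = (leaves g).+1.
Proof.
move=> x0 pg; rewrite /leaves (bigD1_ord x) //= deg_insert_x // eqxx add1n addSn.
congr _.+1; pose a := attach_point x g.
rewrite (bigD1 a) // [RHS](bigD1 a) //= deg_insert_lift // -/a eqxx addn1.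
(* By [degE] the old degree of [a] is positive, so its new degree is not 1. *)
rewrite eqSS {1}degE //= add0n addnC; congr (_ + _).
by apply: eq_bigr => v /negPf va; rewrite deg_insert_lift // -/a va addn0.
Qed.

(** Vertex 1 is on the path and below [x], so the attachment point is not the root. It is then a
    leaf exactly when it ends the path, that is, when the whole path lies below [x]. *)
Lemma deg_attach_point (x : 'I_n.+3) g : 1 < x -> parent_fun g ->
  (deg g (attach_point x g) == 1) = (path_last g < x).
Proof.
move=> x1 pg; have x0 : x != ord0 by apply: contraTneq x1 => ->.
have [ha ax maxa] := attach_pointP x0 g.
have a0 : attach_point x g != ord0.
  by apply: (@lt_neq0 _ ord0); exact: (maxa one (on_path1 pg) x1).
rewrite deg_eq1_path_end // path_endE //.
apply/eqP/idP=> [<- //|lx].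
have el : path_end g (path_last g) by rewrite path_endE.
have [hl _] := andP el.
by apply/val_inj/eqP; rewrite eqn_leq (path_end_max pg el ha) maxa.
Qed.

Lemma attach_point1 (x : 'I_n.+3) g : x = 1 :> nat -> attach_point x g = ord0.
Proof.
move=> x1; have x0 : x != ord0 by rewrite -(inj_eq val_inj) /= x1.
case: (attach_pointP x0 g) => _; rewrite x1 ltnS leqn0 => /eqP a0 _.
exact: val_inj.
Qed.

(* Exchanges the labels 0 and 1; the edge between them is kept. *)
Definition swap01 g : {ffun 'I_n.+2 -> 'I_n.+2} :=
  [ffun v : 'I_n.+2 => if 1 < v then tperm ord0 one (g v) else g v].

Lemma swap01K : involutive swap01.
Proof. by move=> g; apply/ffunP=> v; rewrite !ffunE; case: (1 < v); rewrite ?tpermK. Qed.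

(** Only parents of labels above 1 change, and both 0 and 1 lie below such labels. One implication
    suffices by involutivity. *)
Lemma parent_fun_swap01 g : parent_fun (swap01 g) = parent_fun g.
Proof.
suff W h : parent_fun h -> parent_fun (swap01 h).
  by apply/idP/idP=> [/W|/W //]; rewrite swap01K.
move=> ph; apply/andP; split; first by rewrite ffunE /= parent_fun0.
apply/forallP=> v; apply/implyP=> v0; rewrite ffunE.
have lt := parent_fun_lt ph v0; case: ifP => // v1.
by case: tpermP => // _; exact: ltnW.
Qed.

(** By [degE] degrees depend only on the parents of labels above 1, and the swap applies the
    transposition to these. *)
Lemma deg_swap01 g u : parent_fun g ->
  deg (swap01 g) u = deg g (tperm ord0 one u).
Proof.
move=> pg; rewrite !degE ?parent_fun_swap01 //; congr _.+1.
apply: eq_bigr => w w1; rewrite ffunE w1.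
by rewrite -(inj_eq (@perm_inj _ (tperm ord0 one))) tpermK.
Qed.

Lemma leaves_swap01 g : parent_fun g -> leaves (swap01 g) = leaves g.
Proof.
move=> pg; rewrite /leaves [RHS](reindex_inj (@perm_inj _ (tperm ord0 one))).
by apply: eq_bigr => u _; rewrite deg_swap01.
Qed.

(** * Summation over trees and the recurrence *)

(** A tree has exactly one path end, so after exchanging the sums the inner one collapses to the
    term [i = path_last g]. *)
Lemma sum_R (l : int) a b : b <= n.+2 ->
  \sum_(a <= i < b) R n.+2 l i =
  \sum_(g | parent_fun g) ((Posz (leaves g) == l) && (a <= path_last g < b)).
Proof.
move=> bn; rewrite (big_nat_widen _ _ _ _ _ bn) big_geq_mkord.
transitivity (\sum_(i < n.+2 | (i < b) && (a <= i))
    \sum_(g | parent_fun g) ((Posz (leaves g) == l) && path_end g i)).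
  apply: eq_bigr => i _; rewrite R_parent_fun -sum1dep_card big_mkcondr /=.
  by apply: eq_bigr => g _; case: ifP.
rewrite exchange_big; apply: eq_bigr => g pg.
rewrite big_mkcond (bigD1 (path_last g)) //= path_endE // eqxx andbT.
rewrite big1 ?addn0 => [|i /negPf ne]; last by rewrite path_endE // ne andbF if_same.
by rewrite andbC; case: ifP => _; rewrite ?andbT ?andbF.
Qed.


(** [insert_end x] is a bijection from all parent functions of the smaller size onto those whose
    path ends at [x]. *)
Lemma R_insert_end (l : int) (x : 'I_n.+3) : x != ord0 ->
  R n.+3 l x =
  \sum_(g : {ffun 'I_n.+2 -> 'I_n.+2} | parent_fun g)
    (Posz (leaves (insert_end x g)) == l).
Proof.
move=> x0; rewrite R_parent_fun -big_mkcondr /= sum1dep_card.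
rewrite -[RHS](card_imset _ (@insert_end_inj _ x)).
apply: eq_card => f; rewrite inE; apply/and3P/imsetP.
  case=> pf lf ef; have [g pg e] := insert_end_surj x0 pf ef.
  by exists g => //; rewrite inE pg -e.
case=> g; rewrite inE => /andP[pg lg] ->; split=> //.
  exact: insert_end_parent_fun.
exact: insert_end_path_end.
Qed.

(** The identity holds tree by tree: insertion adds a leaf if [path_last g] is at least [x], and
    keeps the leaf count otherwise. *)
Lemma R_rec_gt1 (l : int) (x : 'I_n.+3) : 1 < x ->
  R n.+3 l x =
  \sum_(x <= i < n.+2) R n.+2 (l - 1)%R i + \sum_(1 <= i < x) R n.+2 l i.
Proof.
move=> x1; have x0 : x != ord0 by apply: contraTneq x1 => ->.
have xn : x <= n.+2 by rewrite -ltnS.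
rewrite R_insert_end // !sum_R // -big_split /=; apply: eq_bigr => g pg.
have := leaves_insert_end x0 pg; rewrite deg_attach_point //.
have := path_last_gt0 pg; have := ltn_ord (path_last g); lia.
Qed.

Lemma R_rec1 (l : int) :
  R n.+3 l 1 = \sum_(2 <= i < n.+2) R n.+2 (l - 1)%R i + R n.+2 l 1.
Proof.
pose x : 'I_n.+3 := Ordinal (isT : 1 < n.+3).
have -> : R n.+2 l 1 = \sum_(1 <= i < 2) R n.+2 l i by rewrite big_nat1.
rewrite !sum_R // (@R_insert_end l x) // -big_split /=.
(* Here the attachment point is the root. The swap turns its having degree 1 into vertex 1 having
   degree 1, which means [path_last g = 1]. *)
rewrite (reindex_inj (inv_inj swap01K)) /=.
apply: eq_big => g; first exact: parent_fun_swap01.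
rewrite parent_fun_swap01 => pg.
have := @leaves_insert_end x (swap01 g) isT; rewrite parent_fun_swap01 => /(_ pg).
rewrite attach_point1 // deg_swap01 // tpermL leaves_swap01 // -path_last_eq1 //.
rewrite -(inj_eq val_inj) /=.
have := path_last_gt0 pg; have := ltn_ord (path_last g); lia.
Qed.

End Leaves.

Theorem theorem7p6 (N : nat) (l : int) (x : nat)
  (hN : 2 < N) (hx1 : 1 <= x) (hxN : x <= N - 1) :
  R N l x =
    \sum_(maxn x 2 <= i < (N - 2).+1) R (N - 1) (l - 1)%R i
    + \sum_(1 <= i < (maxn (x - 1) 1).+1) R (N - 1) l i.
Proof.
case: N hN hxN => [|[|[|n]]] // _; rewrite !subSS !subn0 => hxN.
(* At [x = 1] both maxima are attained by their constants, 2 and 1; from 2 on they are [x] and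
   [x - 1]. *)
case: x hx1 hxN => [|[|x]] // _ hxN; first by rewrite big_nat1 R_rec1.
by rewrite (@R_rec_gt1 _ l (Ordinal (hxN : x.+2 < n.+3))) // subn1 /= (maxn_idPl _).
Qed.
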